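(* Let $\alpha,\beta,\gamma>-1$, let $n\ge 1$ be an integer, and let $s=2n-1$ or $s=2n$. Suppose that there exists a Lobatto-form cubature rule of precision $s$ for the weight $W_{\alpha,\beta,\gamma}$ on the triangle $\triangle$ (as defined in the context), with $N_0$ nodes in the interior of $\triangle$, $N_1$, $N_2$, $N_3$ nodes on the three open sides $y=0$, $x=0$, $x+y=1$ respectively, and one node at each vertex. Then $$ N_0 \ge \begin{cases} \dfrac{n(n-1)}{2} & \text{if } s=2n-1,\\[2mm] \dfrac{n(n-1)}{2}+\left\lfloor \dfrac{n-1}{2}\right\rfloor & \text{if } s=2n,\end{cases} $$ and, for each $i=1,2,3$, $$ N_0+N_i \ge \begin{cases} \dfrac{n(n-1)}{2}+\left\lfloor \dfrac{n-1}{2}\right\rfloor & \text{if } s=2n-1,\\[2mm] \dfrac{n(n+1)}{2} & \text{if } s=2n.\end{cases} $$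
   Context: Let $\triangle=\{(x,y)\in\mathbb{R}^2: 0\le x,\ 0\le y,\ x+y\le 1\}$. For $\alpha,\beta,\gamma>-1$ the Jacobi weight on $\triangle$ is $W_{\alpha,\beta,\gamma}(x,y)=x^\alpha y^\beta(1-x-y)^\gamma$. $\Pi_s^2$ denotes the space of real polynomials in two variables of total degree at most $s$. A Lobatto-form cubature rule of precision $s$ for $W_{\alpha,\beta,\gamma}$ consists of nonnegative integers $N_0,N_1,N_2,N_3$, nodes and weights such that for all $f\in\Pi_s^2$ $$ \begin{aligned} \int_\triangle f(x,y)W_{\alpha,\beta,\gamma}(x,y)\,dx\,dy ={}& \sum_{k=1}^{N_0}\lambda_{k,0}f(x_{k,0},y_{k,0})+\sum_{k=1}^{N_1}\lambda_{k,1}f(x_{k,1},0)+\sum_{k=1}^{N_2}\lambda_{k,2}f(0,y_{k,2})\\ &+\sum_{k=1}^{N_3}\lambda_{k,3}f(x_{k,3},1-x_{k,3})+\mu_0f(0,0)+\mu_1f(1,0)+\mu_2f(0,1), \end{aligned} $$ where the $(x_{k,0},y_{k,0})$ are distinct points in the interior of $\triangle$; the $(x_{k,1},0)$, the $(0,y_{k,2})$ and the $(x_{k,3},1-x_{k,3})$ are distinct points on the sides $y=0$, $x=0$ and $x+y=1$ of $\triangle$ respectively, none of them a vertex (so $x_{k,1},y_{k,2},x_{k,3}\in(0,1)$); and all weights satisfy $\lambda_{k,j}>0$ and $\mu_i>0$. *)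

(* Defs.v *)
From HB Require Import structures.
From mathcomp Require Import all_boot all_order all_algebra.
From mathcomp Require Import all_classical all_reals all_analysis.
From mathcomp Require mpoly.
Import -(notations) mpoly.

Set Implicit Arguments.
Unset Strict Implicit.
Unset Printing Implicit Defensive.

Import Order.TTheory GRing.Theory Num.Theory.
Import numFieldNormedType.Exports.

Local Open Scope classical_set_scope.
Local Open Scope ring_scope.

Definition triangle (R : realType) : set (R * R) :=
  [set z | [/\ 0 <= z.1, 0 <= z.2 & z.1 + z.2 <= 1]].
Arguments triangle R : clear implicits.

(* On the boundary, a null set, the value given by powR is immaterial. *)
Definition jacobi_weight (R : realType) (alpha beta gamma : R) (z : R * R) : R :=
  z.1 `^ alpha * z.2 `^ beta * (1 - z.1 - z.2) `^ gamma.

Definition peval (R : realType) (f : mpoly 2 R) (x y : R) : R :=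
  meval (tnth [tuple x; y]) f.

Definition jacobi_integral (R : realType) (alpha beta gamma : R)
    (f : mpoly 2 R) : \bar R :=
  (\int[@lebesgue_measure R \x @lebesgue_measure R]_(z in triangle R)
     (peval f z.1 z.2 * jacobi_weight alpha beta gamma z)%:E)%E.

Record lobatto_rule (R : realType) (alpha beta gamma : R)
    (s N0 N1 N2 N3 : nat) := LobattoRule {
  node0 : 'I_N0 -> R * R;
  node1 : 'I_N1 -> R; (* abscissas of the nodes (x, 0) *)
  node2 : 'I_N2 -> R; (* ordinates of the nodes (0, y) *)
  node3 : 'I_N3 -> R; (* abscissas of the nodes (x, 1 - x) *)
  weight0 : 'I_N0 -> R;
  weight1 : 'I_N1 -> R;
  weight2 : 'I_N2 -> R;
  weight3 : 'I_N3 -> R;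
  mu0 : R; (* weight of the vertex (0, 0) *)
  mu1 : R; (* weight of the vertex (1, 0) *)
  mu2 : R; (* weight of the vertex (0, 1) *)
  node0_inj : injective node0;
  node1_inj : injective node1;
  node2_inj : injective node2;
  node3_inj : injective node3;
  node0_interior : forall k, interior (triangle R) (node0 k);
  node1_open : forall k, 0 < node1 k < 1;
  node2_open : forall k, 0 < node2 k < 1;
  node3_open : forall k, 0 < node3 k < 1;
  weight0_gt0 : forall k, 0 < weight0 k;
  weight1_gt0 : forall k, 0 < weight1 k;
  weight2_gt0 : forall k, 0 < weight2 k;
  weight3_gt0 : forall k, 0 < weight3 k;
  mu0_gt0 : 0 < mu0;
  mu1_gt0 : 0 < mu1;
  mu2_gt0 : 0 < mu2;
  (* msize is the total degree plus one, and 0 for the zero polynomial. *)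
  lobatto_exact : forall f : mpoly 2 R, (mpoly.msize f <= s.+1)%N ->
    jacobi_integral alpha beta gamma f =
    (\sum_(k < N0) weight0 k * peval f (node0 k).1 (node0 k).2 +
     \sum_(k < N1) weight1 k * peval f (node1 k) 0 +
     \sum_(k < N2) weight2 k * peval f 0 (node2 k) +
     \sum_(k < N3) weight3 k * peval f (node3 k) (1 - node3 k) +
     mu0 * peval f 0 0 + mu1 * peval f 1 0 + mu2 * peval f 0 1)%:E
}.

(* Main.v *)
(* Put z = 1 - x and y = z t. In these coordinates the Jacobi integral of
   z^d t^j is A(z^d) M(t^j) for two positive functionals A and M of one variable,
   and polynomials of degree at most d in (x, y) are spanned by the z^e t^j with
   j <= e <= d. With q_k orthogonal for M and p_{k,j} orthogonal for A(z^(2k) .),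
   the products p_{k,j}(z) z^k q_k(t) of degree k + j are orthogonal.

   Testing the rule on multiples of xy(1-x-y), or of the product of two sides,
   kills the remaining boundary nodes and raises the exponents of the weight, so
   each claim becomes a bound on the number N of nodes of a rule for a Jacobi
   weight. For precision 2m - 2, orthogonality of the products of degree < m on
   the nodes gives N >= m(m+1)/2. For precision 2m - 1, the products of degree m
   restrict to vectors orthogonal to the previous ones, so their Gram matrix G
   has rank at most N - m(m+1)/2. Since multiplications by z and y commute, the
   difference G C^T - C G (C the Jacobi matrix of the q_k, restricted to the
   rows of index < m) does not depend on the rule: it is tridiagonal and
   antisymmetric, with off-diagonal entries multiples of the differences of
   squared norms of p_{k,m-k} and p_{k+1,m-k-1}, which are nonzero by the
   extremal property of orthogonal polynomials. It thus has rank at least m - 1,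
   whence G has rank at least floor(m/2) (Moeller's argument). *)
Require Import Defs.
From HB Require Import structures.
From mathcomp Require Import all_boot all_order all_algebra.
From mathcomp Require Import all_classical all_reals all_analysis.
From mathcomp Require Import measurable_realfun.
From mathcomp Require Import ring lra zify.
From mathcomp Require mpoly.
Import -(notations) mpoly.

Set Implicit Arguments.
Unset Strict Implicit.
Unset Printing Implicit Defensive.

Import Order.TTheory GRing.Theory Num.Theory.

Local Open Scope ring_scope.

(** * Orthogonal polynomials *)

Lemma size_lead_reduce (F : fieldType) (q p : {poly F}) (k : nat) :
  q \is monic -> size q = k.+1 -> (size p <= k.+1)%N ->
  (size (p - p`_k *: q)%R <= k)%N.
Proof.
move=> mq sq sp; apply/leq_sizeP => j.
rewrite leq_eqVlt => /predU1P [<-|kj].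
  rewrite coefB coefZ.
  have -> : q`_k = 1 by have /monicP := mq; rewrite /lead_coef sq.
  by rewrite mulr1 subrr.
rewrite coefB coefZ [p`_j]nth_default ?(leq_trans sp)//.
by rewrite [q`_j]nth_default ?sq// mulr0 subr0.
Qed.

Section OrthogonalPolynomials.
Variables (F : realFieldType) (A : {scalar {poly F}}) (h : {poly F}).
Hypothesis A_gt0 : forall p, p != 0 -> 0 < A (h * p ^+ 2).

Let ip p q := A (h * (p * q)).

Let ipDl p p' q : ip (p + p') q = ip p q + ip p' q.
Proof. by rewrite /ip mulrDl mulrDr linearD. Qed.
Let ipZl c p q : ip (c *: p) q = c * ip p q.
Proof. by rewrite /ip -scalerAl -scalerAr linearZ. Qed.
Let ipC p q : ip p q = ip q p.
Proof. by rewrite /ip (mulrC p). Qed.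
Let ipDr p q q' : ip p (q + q') = ip p q + ip p q'.
Proof. by rewrite ipC ipDl !(ipC p). Qed.
Let ipZr c p q : ip p (c *: q) = c * ip p q.
Proof. by rewrite ipC ipZl (ipC p). Qed.
Let ip0r p : ip p 0 = 0.
Proof. by rewrite /ip !mulr0 linear0. Qed.
Let ip_gt0 p : p != 0 -> 0 < ip p p.
Proof. by rewrite /ip -expr2; exact: A_gt0. Qed.

(** Gram-Schmidt, one degree at a time: the induction hypothesis at ['X^k] gives a monic orthogonal
    [q] of degree [k], and the projection of [f] is corrected by a multiple of [q]. Positivity
    allows the division by [ip q q]. *)
Lemma orthogonal_projection (k : nat) (f : {poly F}) :
  exists2 g : {poly F}, (size g <= k)%N &
    forall p : {poly F}, (size p <= k)%N -> A (h * ((f - g) * p)) = 0.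
Proof.
rewrite -/(ip _ _).
elim: k f => [|k IHk] f.
  exists 0; first by rewrite size_poly0.
  by move=> p; rewrite leqn0 size_poly_eq0 => /eqP ->; exact: ip0r.
have [r sr rO] := IHk 'X^k.
set q := 'X^k - r.
have sq : size q = k.+1 by rewrite size_polyDl size_polyXn // size_polyN ltnS.
have mq : q \is monic.
  by rewrite monicE lead_coefDl ?lead_coefXn// size_polyN size_polyXn ltnS.
have q0 : q != 0 by rewrite -size_poly_eq0 sq.
have [g sg gO] := IHk f.
exists (g + (ip (f - g) q / ip q q) *: q).
  rewrite (leq_trans (size_polyD _ _))// geq_max (leq_trans sg)//=.
  by rewrite (leq_trans (size_scale_leq _ _))// sq.
move=> p sp; rewrite -/(ip _ _).
have sp' := size_lead_reduce mq sq sp.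
rewrite -(subrK (p`_k *: q) p) ipDr ipZr.
set p' := p - _ in sp' *.
have e s : ip (f - (g + (ip (f - g) q / ip q q) *: q)) s =
    ip (f - g) s - (ip (f - g) q / ip q q) * ip q s.
  by rewrite opprD addrA ipDl -scaleNr ipZl mulNr.
rewrite !e [ip (f - g) p']gO// [ip q p']rO// mulr0 subr0 add0r.
by rewrite divfK ?subrr ?mulr0// gt_eqF// ip_gt0.
Qed.

Lemma exists_orthogonal_polynomials :
  exists q : nat -> {poly F}, forall k,
    [/\ q k \is monic, size (q k) = k.+1 &
        forall p : {poly F}, (size p <= k)%N -> A (h * (q k * p)) = 0].
Proof.
suff /choice[q qP] : forall k, exists q : {poly F},
    [/\ q \is monic, size q = k.+1 &
        forall p : {poly F}, (size p <= k)%N -> A (h * (q * p)) = 0].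
  by exists q.
move=> k; have [r sr rO] := orthogonal_projection k 'X^k.
exists ('X^k - r); split=> //.
- by rewrite monicE lead_coefDl ?lead_coefXn// size_polyN size_polyXn ltnS.
- by rewrite size_polyDl size_polyXn // size_polyN ltnS.
Qed.

Variable q : nat -> {poly F}.
Hypothesis q_monic : forall k, q k \is monic.
Hypothesis size_q : forall k, size (q k) = k.+1.
Hypothesis q_orth :
  forall k (p : {poly F}), (size p <= k)%N -> A (h * (q k * p)) = 0.

Lemma orthogonal_norm_gt0 k : 0 < A (h * (q k * q k)).
Proof. by apply: ip_gt0; rewrite monic_neq0. Qed.

Lemma orthogonal_neq j k : j != k -> A (h * (q j * q k)) = 0.
Proof.
rewrite neq_ltn => /orP [jk|kj]; last by apply: q_orth; rewrite size_q.
by rewrite mulrA (mulrAC h) -mulrA q_orth// size_q.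
Qed.

Lemma orthogonal_lead k (p : {poly F}) :
  p \is monic -> size p = k.+1 ->
  A (h * (q k * p)) = A (h * (q k * q k)).
Proof.
move=> mp sp; rewrite -[in LHS](subrK (q k) p) mulrDr mulrDr linearD/=.
rewrite [X in X + _]q_orth ?add0r//.
have -> : q k = p`_k *: q k.
  by have /monicP := mp; rewrite /lead_coef sp => ->; rewrite scale1r.
by rewrite size_lead_reduce// sp.
Qed.

(** The Fourier coefficient along the top [q k] is the coefficient of degree [k] of [p]; removing
    that term lowers the size and keeps the other Fourier coefficients. *)
Lemma orthogonal_expansion k (p : {poly F}) : (size p <= k)%N ->
  p = \sum_(j < k) (A (h * (p * q j)) / A (h * (q j * q j))) *: q j.
Proof.
rewrite -/(ip _ _); elim: k p => [|k IHk] p sp.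
  by rewrite big_ord0; apply/eqP; rewrite -size_poly_eq0 -leqn0.
have sp' := size_lead_reduce (q_monic k) (size_q k) sp.
rewrite big_ord_recr/=.
have pE := subrK (p`_k *: q k) p.
have -> : A (h * (p * q k)) / A (h * (q k * q k)) = p`_k.
  rewrite -[X in A (h * (X * _))]pE -/(ip _ _) ipDl ipZl ipC [ip _ _]q_orth//.
  by rewrite add0r mulfK// gt_eqF// orthogonal_norm_gt0.
rewrite -[LHS]pE; congr (_ + _); rewrite [LHS]IHk//.
apply: eq_bigr => j _; congr (_ / _ *: _).
rewrite -[in RHS]pE [RHS]ipDl [X in _ = _ + X]ipZl.
by rewrite [X in _ + _ * X]orthogonal_neq ?mulr0 ?addr0// gtn_eqF.
Qed.

End OrthogonalPolynomials.

(** * Cubature in collapsed coordinates *)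

Section TriangleCubature.
Variables (F : realFieldType) (A M : {scalar {poly F}}).
Hypothesis A_gt0 : forall k (p : {poly F}), p != 0 -> 0 < A ('X^k * p ^+ 2).
(** The factor [1] stands for the weight [h] of the one-variable results. *)
Hypothesis M_gt0 : forall p : {poly F}, p != 0 -> 0 < M (1 * p ^+ 2).

Variables (N s : nat) (w z t : 'I_N -> F).
(** Since y = z t, the monomial z^d t^j is z^(d-j) y^j, a polynomial of degree d in x and y when j
    <= d. *)
Hypothesis exact_monomial : forall d j, (j <= d <= s)%N ->
  \sum_i w i * (z i ^+ d * t i ^+ j) = A 'X^d * M 'X^j.

Let B (u v : {poly F}) := \sum_i w i * (u.[z i] * v.[t i]).

Let BDr u v v' : B u (v + v') = B u v + B u v'.
Proof.
by rewrite /B -big_split/=; apply: eq_bigr => i _; rewrite hornerD !mulrDr.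
Qed.
Let BZr u c v : B u (c *: v) = c * B u v.
Proof.
by rewrite /B mulr_sumr; apply: eq_bigr => i _; rewrite hornerZ; ring.
Qed.
Let B0r u : B u 0 = 0.
Proof. by rewrite -(scale0r 0) BZr mul0r. Qed.
Let BDl u u' v : B (u + u') v = B u v + B u' v.
Proof.
by rewrite /B -big_split/=; apply: eq_bigr => i _; rewrite hornerD mulrDl mulrDr.
Qed.
Let BZl c u v : B (c *: u) v = c * B u v.
Proof.
by rewrite /B mulr_sumr; apply: eq_bigr => i _; rewrite hornerZ; ring.
Qed.
Let B0l v : B 0 v = 0.
Proof. by rewrite -(scale0r 0) BZl mul0r. Qed.

(** Every monomial z^d t^j of the product satisfies j <= k <= d <= s, so the rule is exact on it. *)
Lemma exact_product k (u v : {poly F}) :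
  (size v <= k.+1)%N -> (size u + k <= s.+1)%N ->
  B ('X^k * u) v = A ('X^k * u) * M v.
Proof.
move=> sv su.
rewrite -[u]coefK -[v]coefK !poly_def mulr_sumr !raddf_sum/=.
rewrite (big_morph (B _) (BDr _) (B0r _)) mulr_sumr.
apply: eq_bigr => j _; rewrite BZr linearZ/= mulrCA; congr (_ * _).
rewrite (big_morph (B^~ _) (fun x y => BDl x y _) (B0l _)) mulr_suml.
apply: eq_bigr => i _; rewrite -scalerAr BZl linearZ/= -mulrA; congr (_ * _).
rewrite -exprD -exact_monomial.
  by apply: eq_bigr => a _; rewrite !hornerXn.
apply/andP; split.
  by rewrite (leq_trans _ (leq_addr _ _))// -ltnS (leq_trans (ltn_ord j)).
by rewrite -ltnS addnC (leq_trans _ su)// ltn_add2r.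
Qed.

Variables (q : nat -> {poly F}) (p : nat -> nat -> {poly F}).
Hypothesis q_monic : forall k, q k \is monic.
Hypothesis size_q : forall k, size (q k) = k.+1.
Hypothesis q_orth :
  forall k (r : {poly F}), (size r <= k)%N -> M (1 * (q k * r)) = 0.
Hypothesis p_monic : forall k j, p k j \is monic.
Hypothesis size_p : forall k j, size (p k j) = j.+1.
Hypothesis p_orth : forall k j (r : {poly F}), (size r <= j)%N ->
  A ('X^(k + k) * (p k j * r)) = 0.

Let kappa k := M (1 * (q k * q k)).
Let nu k j := A ('X^(k + k) * (p k j * p k j)).

Let kappa_gt0 k : 0 < kappa k.
Proof. exact: (orthogonal_norm_gt0 M_gt0). Qed.
Let nu_gt0 k j : 0 < nu k j.
Proof. exact: (orthogonal_norm_gt0 (A_gt0 (k + k))). Qed.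

(* Both sides minimize over monic polynomials of degree [j.+1], the right hand
   side under the additional constraint of vanishing at 0. *)
Lemma nu_lt k j : nu k j.+1 < nu k.+1 j.
Proof.
set g := 'X * p k.+1 j; set e := g - p k j.+1.
have mg : g \is monic by rewrite monicMl ?monicX.
have sg : size g = j.+2.
  by rewrite size_monicM ?monicX ?size_polyX ?size_p// monic_neq0.
have se : (size e <= j.+1)%N.
  have := size_lead_reduce (p_monic k j.+1) (size_p k j.+1).
  move=> /(_ g); rewrite sg => /(_ (leqnn _)).
  by have /monicP := mg; rewrite /lead_coef sg => ->; rewrite scale1r.
(* Otherwise [p k j.+1] is ['X * p k.+1 j], and its orthogonality to [p k.+1 j] contradicts the
   positivity of [A] for the odd power of exponent 2k + 1. *)
have e0 : e != 0.
  apply/eqP => /eqP; rewrite subr_eq0 => /eqP gE.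
  have := p_orth k (r := p k.+1 j) (eq_leq (size_p _ _)).
  rewrite -gE; apply/eqP; rewrite gt_eqF//.
  have := A_gt0 (k + k).+1 (monic_neq0 (p_monic k.+1 j)).
  by rewrite exprSr expr2 /g -!mulrA.
have -> : nu k.+1 j = A ('X^(k + k) * (g * g)).
  by rewrite /nu /g; congr (A _); rewrite addnS addSn !exprSr; ring.
have -> : g = p k j.+1 + e by rewrite addrC subrK.
(* Pythagoras: the cross terms vanish because [e] has degree at most [j]. *)
have -> : 'X^(k + k) * ((p k j.+1 + e) * (p k j.+1 + e)) =
    'X^(k + k) * (p k j.+1 * p k j.+1) +
    ('X^(k + k) * (p k j.+1 * e) + 'X^(k + k) * (p k j.+1 * e)) +
    'X^(k + k) * e ^+ 2 by ring.
by rewrite !linearD/= (p_orth k se) !addr0 ltrDl A_gt0.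
Qed.

Let f k j i := (('X^k * p k j).[z i]) * (q k).[t i].

Let f_prod k j k' j' : \sum_i w i * (f k j i * f k' j' i) =
  B ('X^(k + k') * (p k j * p k' j')) (q k * q k').
Proof.
apply: eq_bigr => i _; congr (_ * _); rewrite /f !hornerM !hornerXn exprD; ring.
Qed.

Let size_qq k k' : (size (q k * q k')%R <= (k + k').+1)%N.
Proof. by rewrite (leq_trans (size_polyMleq _ _))// !size_q; lia. Qed.

Let size_pp k j k' j' : (size (p k j * p k' j')%R <= (j + j').+1)%N.
Proof. by rewrite (leq_trans (size_polyMleq _ _))// !size_p; lia. Qed.

(** Exactness splits the sum into a factor of [A] and one of [M]. The latter vanishes unless k = k',
    and then the weight z^(2k) is the one for which the [p k j] are orthogonal. *)
Lemma gram_f k j k' j' : (k + j + (k' + j') <= s)%N ->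
  \sum_i w i * (f k j i * f k' j' i) =
  nu k j * kappa k *+ ((k == k') && (j == j')).
Proof.
move=> ds; rewrite f_prod exact_product//; last first.
  by have := size_pp k j k' j'; lia.
have [<-|kk'] := eqVneq k k'; last first.
  by rewrite -(mul1r (q k * _)) (orthogonal_neq size_q q_orth)// mulr0.
have [<-|jj'] := eqVneq j j'; first by rewrite mulr1n /nu /kappa mul1r.
by rewrite (orthogonal_neq (size_p k) (p_orth k))// mul0r.
Qed.

(** * Gram matrices on the nodes and the bound for even precision *)

Let W := diag_mx (\row_i w i).

Let mulW_entry a b (U : 'M[F]_(a, N)) (V : 'M[F]_(b, N)) i j :
  (U *m W *m V^T) i j = \sum_k w k * (U i k * V j k).
Proof.
rewrite mxE; apply: eq_bigr => k _.
by rewrite mul_mx_diag !mxE mulrAC mulrC.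
Qed.

(** Pairs (k, j) with k + j < m, which index the products of degree below m. *)
Let idx m := {k : 'I_m & 'I_(m - k)}.
Let fdeg m (x : idx m) : nat * nat := (tag x : nat, tagged x : nat).
Let Fm m : 'M[F]_(#|{: idx m}|, N) :=
  \matrix_(a, i) f (fdeg (enum_val a)).1 (fdeg (enum_val a)).2 i.

Let card_idx m : #|{: idx m}| = (m * m.+1)./2.
Proof.
rewrite card_tagged sumnE big_map big_enum/=.
under eq_bigr do rewrite card_ord.
rewrite -(big_mkord xpredT (fun k => m - k)%N) big_nat_rev/= add0n.
under eq_big_nat => k km do rewrite subKn//.
by rewrite mulnC -[in RHS](bin2 m.+1) -bin2_sum big_nat_recl// add0n.
Qed.

(** The weighted Gram matrix of the rows is diagonal with positive entries, so the rows are
    independent. The degrees involved reach at most 2m - 2. *)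
Lemma rank_f m : (2 * m <= s.+2)%N -> \rank (Fm m) = (m * m.+1)./2.
Proof.
move=> ms; rewrite -card_idx; apply/eqP; rewrite eqn_leq rank_leq_row/=.
set D : 'rV_(#|{: idx m}|) := \row_a
  (nu (fdeg (enum_val a)).1 (fdeg (enum_val a)).2 *
     kappa (fdeg (enum_val a)).1).
have DE : Fm m *m W *m (Fm m)^T = diag_mx D.
  apply/matrixP => a b; rewrite mulW_entry !mxE.
  under eq_bigr do rewrite !mxE.
  rewrite gram_f; last first.
    case: (enum_val a) (enum_val b) => [k j] [k' j']; rewrite /fdeg/=.
    by have := ltn_ord j; have := ltn_ord j'; lia.
  congr (_ *+ nat_of_bool _).
  rewrite -(inj_eq enum_val_inj).
  move: (enum_val a) (enum_val b) => x y.
  apply/idP/eqP => [|->]; last by rewrite !eqxx.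
  case: x y => [k j] [k' j'] /andP [/eqP/val_inj/= e].
  by move: j'; rewrite -e => j' /eqP/val_inj/= ->.
have : \rank (diag_mx D) = #|{: idx m}|.
  apply: mxrank_unit; rewrite unitmxE det_diag unitfE.
  by apply/prodf_neq0 => a _; rewrite mxE mulf_neq0// gt_eqF.
by move=> D_rank; rewrite -[leqLHS]D_rank -DE -mulmxA mxrankM_maxl.
Qed.

Lemma cubature_bound_even m : (2 * m <= s.+2)%N -> ((m * m.+1)./2 <= N)%N.
Proof. by move=> /rank_f <-; exact: rank_leq_col. Qed.

(** * The Jacobi matrix of [q] and the bound for odd precision *)

Let T k l := M (1 * ('X * q k * q l)).

Let T_sym k l : T k l = T l k.
Proof. by rewrite /T mulrAC. Qed.

Let T_eq0 k l : (k.+1 < l)%N -> T k l = 0.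
Proof.
move=> kl; rewrite /T (mulrC _ (q l)) q_orth//.
by rewrite size_monicM ?monicX ?monic_neq0// size_polyX size_q.
Qed.

Let T_succ k : T k k.+1 = kappa k.+1.
Proof.
rewrite /T (mulrC _ (q k.+1)) (orthogonal_lead q_monic size_q q_orth)//.
  by rewrite monicMl ?monicX.
by rewrite size_monicM ?monicX ?monic_neq0// size_polyX size_q.
Qed.

Let mulXq n l : (l < n)%N ->
  'X * q l = \sum_(j < n.+1) (T l j / kappa j) *: q j.
Proof.
move=> ln; apply: (orthogonal_expansion M_gt0 q_monic size_q q_orth).
by rewrite size_monicM ?monicX ?monic_neq0// size_polyX size_q.
Qed.

(* The error of the rule at [z ^ (2 n) v(t)], whose degree may exceed [s]. *)
Let Phi n v := B 'X^(n + n) v - A 'X^(n + n) * M v.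

Let PhiZ n c v : Phi n (c *: v) = c * Phi n v.
Proof. by rewrite /Phi BZr linearZ/=; ring. Qed.

Let PhiE n I r (P : pred I) (v : I -> {poly F}) :
  Phi n (\sum_(i <- r | P i) v i) = \sum_(i <- r | P i) Phi n (v i).
Proof.
apply: (big_morph (Phi n)) => [u u'|]; last first.
  by rewrite /Phi B0r linear0 mulr0 subrr.
by rewrite /Phi BDr linearD/=; ring.
Qed.

(** Since [P] is monic of degree [d], z^(k+j) P(z) differs from z^(2n) only by lower powers, where
    the rule is exact. The whole error thus comes from z^(2n). *)
Let gram_top n k j : (k <= n)%N -> (j <= n)%N -> (2 * n <= s.+1)%N ->
  \sum_i w i * (f k (n - k) i * f j (n - j) i) =
  Phi n (q k * q j) + nu k (n - k) * kappa k *+ (k == j).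
Proof.
move=> kn jn ns; rewrite f_prod.
set P := p k (n - k) * p j (n - j); set d := (n - k + (n - j))%N.
have mP : P \is monic by rewrite monicMl.
have sP : size P = d.+1 by rewrite size_monicM ?monic_neq0// !size_p /d; lia.
have sr : (size (P - 'X^d)%R <= d)%N.
  have := size_lead_reduce (monicXn F d) (size_polyXn _ d) (eq_leq sP).
  by have /monicP := mP; rewrite /lead_coef sP => ->; rewrite scale1r.
rewrite -[in LHS](subrK 'X^d P) mulrDr BDl exact_product//; last first.
  by rewrite (leq_trans (leq_add sr (leqnn _)))// /d; lia.
have -> : nu k (n - k) * kappa k *+ (k == j) =
    A ('X^(k + j) * P) * M (q k * q j).
  rewrite /P; have [<-|kj] := eqVneq k j; first by rewrite mulr1n /nu /kappa mul1r.
  by rewrite -(mul1r (q k * _)) (orthogonal_neq size_q q_orth)// mulr0.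
rewrite mulrBr linearB/= -exprD.
have -> : (k + j + d = n + n)%N by rewrite /d; lia.
by rewrite /Phi; ring.
Qed.

(* [G] is the Gram matrix on the nodes of the top degree products, which are
   orthogonal there to all products of lower degree. Multiplying [q k] by [z]
   (row [k] of the identity) and by [y = z t] (row [k] of the Jacobi matrix
   [T k j / kappa j]) commutes, so in [Om] the unknown part [Phi] of [G] cancels
   and an explicit matrix of rank at least [m.-1] remains. *)
Lemma cubature_bound_odd m : (2 * m <= s.+1)%N ->
  ((m * m.+1)./2 + m./2 <= N)%N.
Proof.
move=> ms; case: m => [|n] in ms *; first by [].
pose E := \matrix_(k < n.+2, i < N) f k (n.+1 - k) i.
pose G := E *m W *m E^T.
(* Rows are taken at index k and columns at l + 1: this shift brings the superdiagonal of the
   tridiagonal difference onto the diagonal of [Om]. All indices stay at most n, so multiplication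
   by ['X] remains within [q 0], ..., [q n.+1]. *)
pose r0 (k : 'I_n) : 'I_n.+2 := inord k.
pose r1 (k : 'I_n) : 'I_n.+2 := inord k.+1.
pose C0 := \matrix_(k < n, j < n.+2) (T k j / kappa j).
pose C1 := \matrix_(k < n, j < n.+2) (T k.+1 j / kappa j).
pose Om := rowsub r0 1%:M *m G *m C1^T - C0 *m G *m colsub r1 1%:M.
have GE k j : (k <= n.+1)%N -> (j <= n.+1)%N -> G (inord k) (inord j) =
    Phi n.+1 (q k * q j) + nu k (n.+1 - k) * kappa k *+ (k == j).
  move=> kn jn; rewrite -gram_top// mulW_entry.
  by apply: eq_bigr => i _; rewrite !mxE !inordK.
have GCE k l : (k < n.+1)%N -> (l < n.+1)%N ->
    \sum_j G (inord k) j * (T l j / kappa j) =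
    Phi n.+1 ('X * (q k * q l)) + nu k (n.+1 - k) * T l k.
  move=> kn ln; rewrite mulrCA (mulXq ln) mulr_sumr PhiE.
  have kn2 : (k < n.+2)%N by exact: ltnW.
  have -> : nu k (n.+1 - k) * T l k = \sum_(j < n.+2)
      (nu k (n.+1 - k) * kappa k *+ (k == j)) * (T l j / kappa j).
    rewrite (bigD1 (inord k))//= inordK// eqxx big1 ?addr0.
      by rewrite mulr1n -mulrA (mulrC (kappa k)) divfK// gt_eqF.
    move=> j jk; suff /negbTE -> : k != j by rewrite mulr0n mul0r.
    by apply: contraNneq jk => ->; rewrite inord_val.
  rewrite -big_split/=; apply: eq_bigr => j _.
  rewrite -[in LHS](inord_val j) GE ?inord_val; [|lia|by rewrite -ltnS].
  by rewrite -scalerAr PhiZ mulrDl (mulrC (Phi _ _)).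
have OmE (k l : 'I_n) :
    Om k l = T k l.+1 * (nu k (n.+1 - k) - nu l.+1 (n - l)).
  have G_sym i j : G i j = G j i.
    by rewrite !mulW_entry; apply: eq_bigr => a _; rewrite (mulrC (E i a)).
  have -> : Om k l = \sum_j G (r0 k) j * (T l.+1 j / kappa j) -
      \sum_j G (r1 l) j * (T k j / kappa j).
    rewrite /Om mul_rowsub_mx mul1mx mulmx_colsub mulmx1 [LHS]mxE.
    congr (_ + _).
      rewrite [LHS]mxE; apply: eq_bigr => j _.
      by rewrite [C1^T _ _]mxE [C1 _ _]mxE [rowsub _ _ _ _]mxE.
    rewrite [LHS]mxE; congr (- _).
    rewrite [LHS]mxE [LHS]mxE; apply: eq_bigr => j _.
    by rewrite [C0 _ _]mxE G_sym mulrC.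
  have kn := ltn_ord k; have ln := ltn_ord l.
  rewrite !GCE; try lia.
  by rewrite subSS (T_sym l.+1) (mulrC (q l.+1)); ring.
(* [Om] is lower triangular because T k (l+1) vanishes for k < l, and its diagonal entries are
   nonzero by [nu_lt]. *)
have Om_rank : \rank Om = n.
  apply: mxrank_unit; rewrite unitmxE det_trig.
    rewrite unitfE; apply/prodf_neq0 => k _.
    rewrite OmE T_succ mulf_neq0//; first by rewrite gt_eqF.
    by rewrite subr_eq0 lt_eqF// subSn ?nu_lt// ltnW.
  by apply/is_trig_mxP => k l kl; rewrite OmE T_eq0 ?mul0r.
have G_rank : (\rank G <= \rank (E *m W))%N by rewrite /G mxrankM_maxl.
(* A product of degree n + 1 against one of degree at most n has total degree at most 2n + 1, within
   the precision. Hence the ranks of [E *m W] and [Fm n.+1] add up to at most N. *)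
have EW0 : E *m W *m (Fm n.+1)^T = 0.
  apply/matrixP => k a; rewrite mulW_entry [RHS]mxE.
  under eq_bigr do rewrite !mxE.
  have := ltn_ord k; case: (enum_val a) => [k' j']; rewrite /fdeg/=.
  have := ltn_ord j' => j'k' kn; rewrite gram_f; last lia.
  suff -> : (k == k' :> nat) && (n.+1 - k == j')%N = false by [].
  by apply/negP => /andP[/eqP ->]; rewrite gtn_eqF.
have := mulmx0_rank_max EW0; rewrite mxrank_tr rank_f; last by lia.
have : (\rank Om <= \rank G + \rank G)%N.
  apply: leq_trans (mxrank_add _ _) _; rewrite mxrank_opp leq_add//.
    by rewrite (leq_trans (mxrankM_maxl _ _))// mxrankM_maxr.
  by rewrite (leq_trans (mxrankM_maxl _ _))// mxrankM_maxr.
(* From n <= 2 rank G, the rank of G is at least the ceiling of n/2, which is the floor of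
   (n+1)/2. *)
rewrite Om_rank; move: G_rank; lia.
Qed.

End TriangleCubature.

Lemma collapsed_cubature_bound (F : realFieldType) (A M : {scalar {poly F}})
    (N s m : nat) (w z t : 'I_N -> F) :
  (forall k (p : {poly F}), p != 0 -> 0 < A ('X^k * p ^+ 2)) ->
  (forall p : {poly F}, p != 0 -> 0 < M (p ^+ 2)) ->
  (forall d j, (j <= d <= s)%N ->
     \sum_i w i * (z i ^+ d * t i ^+ j) = A 'X^d * M 'X^j) ->
  ((2 * m <= s.+2)%N -> ((m * m.+1)./2 <= N)%N) /\
  ((2 * m <= s.+1)%N -> ((m * m.+1)./2 + m./2 <= N)%N).
Proof.
move=> A_gt0 M_gt0 exact_monomial.
have M_gt0' (p : {poly F}) : p != 0 -> 0 < M (1 * p ^+ 2).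
  by rewrite mul1r; exact: M_gt0.
have [q qP] := exists_orthogonal_polynomials M_gt0'.
have /choice[p pP] k := exists_orthogonal_polynomials (A_gt0 (k + k)%N).
have qm k : q k \is monic by have [] := qP k.
have qs k : size (q k) = k.+1 by have [] := qP k.
have qo k (r : {poly F}) : (size r <= k)%N -> M (1 * (q k * r)) = 0.
  by have [_ _] := qP k; exact.
have pm k j : p k j \is monic by have [] := pP k j.
have ps k j : size (p k j) = j.+1 by have [] := pP k j.
have po k j (r : {poly F}) : (size r <= j)%N -> A ('X^(k + k) * (p k j * r)) = 0.
  by have [_ _] := pP k j; exact.
split=> ms.
  exact: (cubature_bound_even A_gt0 M_gt0' exact_monomial qm qs qo pm ps po).
exact: (cubature_bound_odd A_gt0 M_gt0' exact_monomial qm qs qo pm ps po).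
Qed.

(** * Jacobi moments on the triangle *)

Import numFieldNormedType.Exports.

(** The ring is arbitrary so that the same expression serves for real values and for polynomials. *)
Definition side_factor (F : pzRingType) (a b c : nat) (x y : F) : F :=
  x ^+ a * y ^+ b * (1 - x - y) ^+ c.

Section Analysis.
Local Open Scope classical_set_scope.
Context {R : realType}.
Local Notation mu := (@lebesgue_measure R).

(** Lebesgue measure is determined by its values on half-open intervals, and [c] times its image
    under the dilation has the same values. *)
Lemma ge0_integral_dilation (c : R) (g : R -> \bar R) : 0 < c ->
  measurable_fun [set: R] g -> (forall y, (0 <= g y)%E) ->
  (\int[mu]_y g y = c%:E * \int[mu]_t g (c * t)%R)%E.
Proof.
move=> c0 mg g0.
have mc : measurable_fun [set: R] ( *%R c : R -> measurableTypeR R).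
  exact: mulrl_measurable.
have mu_dilation (m : {measure set (measurableTypeR R) -> \bar R}) :
    (forall A, m A = mu ( *%R c @^-1` A)) ->
    (\int[mu]_y g y = c%:E * \int[m]_y g y)%E.
  move=> mE; rewrite -(@ge0_integral_mscale _ _ _ m _ _ (NngNum (ltW c0)))//.
  apply: eq_measure_integral => A mA _.
  apply: lebesgue_measure_unique => //= _ [[a b]] _ <-/=.
  rewrite /mscale/= mE.
  have -> : ( *%R c) @^-1` `]a, b] = `](c^-1 * a), (c^-1 * b)]%classic.
    apply/seteqP; split => x /=; rewrite !in_itv/=.
      by rewrite ler_pdivlMl// ltr_pdivrMl.
    by rewrite ler_pdivlMl// ltr_pdivrMl.
  rewrite !lebesgue_measure_itv/= !lte_fin ltr_pM2l ?invr_gt0//.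
  case: ifPn => // _; last by rewrite mule0.
  by rewrite -!EFinD -EFinM -mulrBr mulVKf// gt_eqF.
rewrite (mu_dilation (pushforward mu ( *%R c : R -> measurableTypeR R)))//.
by rewrite ge0_integral_pushforward// preimage_setT.
Qed.

Lemma finite_poly_roots (p : {poly R}) : p != 0 -> finite_set [set x | root p x].
Proof.
move=> p0; apply: contrapT => p_inf.
have [B Bp sB] := infinite_set_fset (size p) p_inf.
have /(max_poly_roots p0)/(_ (finmap.fset_uniq B)) :
    all (root p) (finmap.enum_fset B).
  by apply/allP => x /Bp.
by rewrite ltnNge sB.
Qed.

(** A zero integral would make [f] vanish almost everywhere, so the unit interval would be
    negligible up to a finite set. *)
Lemma integral_gt0_cofinite (D C : set R) (f : R -> R) : measurable D ->
  measurable_fun D f -> `]0, 1[ `<=` D -> finite_set C ->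
  (forall x, D x -> 0 <= f x) -> (forall x, 0 < x < 1 -> ~ C x -> 0 < f x) ->
  (0 < \int[mu]_(x in D) (f x)%:E)%E.
Proof.
move=> mD mf ID fC f0 fpos.
rewrite lt0e integral_ge0 ?andbT => [|x Dx]; last by rewrite lee_fin f0.
apply/eqP => I0.
have : (\int[mu]_(x in D) `|(f x)%:E| = 0)%E.
  rewrite -[RHS]I0; apply: eq_integral => x /set_mem Dx.
  by rewrite gee0_abs// lee_fin f0.
have mEf : measurable_fun D (EFin \o f) by exact/measurable_EFinP.
move=> /(ae_eq_integral_abs mu mD mEf).
move=> ae0.
have NI : mu.-negligible (`]0, 1[ : set R).
  have : mu.-negligible (~` [set x | D x -> (f x)%:E = 0%E] `|` C).
    apply: negligibleU; first exact: ae0.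
    apply: (@negligibleS _ _ _ mu C C) => //; exists C; split => //.
      apply: countable_measurable; last exact: finite_set_countable.
      by move=> t; exact: measurable_set1.
    by apply: countable_lebesgue_measure0; apply: finite_set_countable.
  apply: negligibleS => x /= x01; have [Cx|Cx] := pselect (C x); first by right.
  left=> /(_ (ID _ x01)) /eqP; rewrite eqe; apply/negP; rewrite gt_eqF//.
  by apply: fpos => //; rewrite in_itv/= in x01.
have /eqP : mu (`]0, 1[ : set R) = 0%E by apply/negligibleP.
rewrite /= lebesgue_measure_itv/= lte_fin ltr01.
by rewrite -EFinD eqe subr0 oner_eq0.
Qed.

Lemma horner_norm_le (p : {poly R}) (u : R) : 0 <= u <= 1 ->
  `|p.[u]| <= \sum_(i < size p) `|p`_i|.
Proof.
move=> /andP[u0 u1]; rewrite horner_coef (le_trans (ler_norm_sum _ _ _))//.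
apply: ler_sum => i _; rewrite normrM ler_piMr// normrX exprn_ile1//.
by rewrite ger0_norm.
Qed.

Lemma integrable_poly_weight (D : set R) (phi g : R -> R) (p : {poly R}) :
  measurable D -> measurable_fun [set: R] phi ->
  (forall x, D x -> 0 <= phi x <= 1) -> mu.-integrable D (EFin \o g) ->
  mu.-integrable D (fun x => (p.[phi x] * g x)%:E).
Proof.
move=> mD mphi phi01 ig.
have mg : measurable_fun D g.
  by have /measurable_EFinP := measurable_int mu ig.
pose C := \sum_(i < size p) `|p`_i|.
have C0 : 0 <= C by apply: sumr_ge0.
have Cig : mu.-integrable D (fun x => C%:E * (EFin \o g) x)%E.
  exact: integrableZl.
apply: le_integrable Cig => //.
  apply/measurable_EFinP/measurable_funM => //.
  apply: (measurableT_comp (f := horner p) (g := phi)).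
    exact: measurable_poly.
  exact: measurable_funTS.
move=> x Dx /=; rewrite lee_fin !normrM (ger0_norm C0) ler_wpM2r//.
exact/horner_norm_le/phi01.
Qed.

(** Used with [phi] equal to 1 - x for [A] and to the identity for [M]. Polynomials are bounded on
    the unit interval, so all integrals are finite and linearity holds in the reals. *)
Lemma exists_weighted_functional (D : set R) (phi g : R -> R) :
  measurable D -> measurable_fun [set: R] phi ->
  (forall x, D x -> 0 <= phi x <= 1) -> mu.-integrable D (EFin \o g) ->
  exists A : {scalar {poly R}}, forall p : {poly R},
    (\int[mu]_(x in D) (p.[phi x] * g x)%:E = (A p)%:E)%E.
Proof.
move=> mD mphi phi01 ig.
have ipg p : mu.-integrable D (EFin \o (fun x => p.[phi x] * g x)).
  exact: integrable_poly_weight.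
pose I (p : {poly R}) : R := \int[mu]_(x in D) (p.[phi x] * g x).
have I_linear : scalar I.
  move=> c p q.
  transitivity (\int[mu]_(x in D)
      (c * (p.[phi x] * g x) + q.[phi x] * g x))%R.
    by apply: eq_Rintegral => x _; rewrite hornerD hornerZ; ring.
  rewrite RintegralD//; first by rewrite RintegralZl// ipg.
  have := ipg p; exact: integrableZl.
pose A : {scalar {poly R}} := HB.pack I (GRing.isLinear.Build _ _ _ _ I I_linear).
exists A => p; rewrite /A/= /I fineK//.
by apply: integrable_fin_num => //; exact: ipg.
Qed.

Lemma weighted_functional_gt0 (D : set R) (phi g : R -> R)
    (A : {scalar {poly R}}) (p : {poly R}) (k : nat) :
  measurable D -> `]0, 1[ `<=` D -> injective phi ->
  measurable_fun [set: R] phi -> measurable_fun D g ->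
  (forall x, D x -> 0 <= phi x) -> (forall x, D x -> 0 <= g x) ->
  (forall x, 0 < x < 1 -> 0 < phi x) -> (forall x, 0 < x < 1 -> 0 < g x) ->
  (forall p : {poly R},
    (\int[mu]_(x in D) (p.[phi x] * g x)%:E = (A p)%:E)%E) ->
  p != 0 -> 0 < A ('X^k * p ^+ 2).
Proof.
move=> mD ID phi_inj mphi mg phi0 g0 phi_gt0 g_gt0 AE p0.
rewrite -lte_fin -AE.
apply: (@integral_gt0_cofinite D (phi @^-1` [set u | root p u])) => //.
- apply: measurable_funM => //.
  apply: (measurableT_comp (f := horner ('X^k * p ^+ 2)) (g := phi)).
    exact: measurable_poly.
  exact: measurable_funTS.
- by apply: finite_preimage (finite_poly_roots p0) => x y _ _; exact: phi_inj.
- move=> x Dx; rewrite hornerM hornerXn horner_exp mulr_ge0 ?g0//.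
  by rewrite mulr_ge0 ?sqr_ge0// exprn_ge0 ?phi0.
- move=> x x01 px; rewrite hornerM hornerXn horner_exp mulr_gt0 ?g_gt0//.
  rewrite mulr_gt0//; first by rewrite exprn_gt0 ?phi_gt0.
  by rewrite lt0r sqr_ge0 andbT sqrf_eq0; apply/negP.
Qed.

Lemma measurable_fun_powR d (T : measurableType d) (h : T -> R) (r : R) :
  measurable_fun setT h -> measurable_fun setT (fun z => h z `^ r).
Proof. by move=> mh; exact: (measurableT_comp (measurable_powR r) mh). Qed.

(** * Separation of the moments by the collapsed substitution *)

Variables (alpha beta gamma : R) (a b c : nat).

(* The weights in [x] and [t] after the substitution [y = (1 - x) t], whose
   Jacobian accounts for the successor in the exponent of [1 - x]. *)
Let wA (x : R) := x ^+ a * x `^ alpha *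
  ((1 - x) ^+ (b + c).+1 * (1 - x) `^ beta * (1 - x) `^ gamma).
Let wM (t : R) := t ^+ b * t `^ beta * ((1 - t) ^+ c * (1 - t) `^ gamma).

Lemma measurable_triangle : measurable (triangle R).
Proof.
have -> : triangle R = (fst @^-1` `[0, +oo[) `&` ((snd @^-1` `[0, +oo[) `&`
    ((fun z : R * R => z.1 + z.2) @^-1` `]-oo, 1])).
  apply/seteqP; split => z /=; rewrite !in_itv/= !andbT; first by case.
  by case=> ? [? ?].
apply: measurableI; last apply: measurableI.
- by rewrite -[X in measurable X]setTI; exact: measurable_fst.
- by rewrite -[X in measurable X]setTI; exact: measurable_snd.
- rewrite -[X in measurable X]setTI.
  by apply: measurable_funD.
Qed.

Let moment_integrand i j (z : R * R) :=
  side_factor a b c z.1 z.2 * ((1 - z.1) ^+ i * z.2 ^+ j) *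
  jacobi_weight alpha beta gamma z.

Let measurable_moment_integrand i j :
  measurable_fun [set: R * R] (moment_integrand i j).
Proof.
have m1 : measurable_fun [set: R * R] (fun z => 1 - z.1 - z.2).
  by apply: measurable_funB => //; exact: measurable_funB.
have m2 : measurable_fun [set: R * R] (fun z => 1 - z.1).
  exact: measurable_funB.
apply: measurable_funM.
  apply: measurable_funM; last by apply: measurable_funM; exact: measurable_funX.
  apply: measurable_funM; last exact: measurable_funX.
  by apply: measurable_funM; exact: measurable_funX.
apply: measurable_funM; last exact: measurable_fun_powR.
by apply: measurable_funM; exact: measurable_fun_powR.
Qed.

Let moment_integrand_ge0 i j z : triangle R z -> 0 <= moment_integrand i j z.
Proof.
case: z => x y [/= x0 y0 xy1].
rewrite mulr_ge0//; last by rewrite !mulr_ge0// powR_ge0.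
by rewrite !mulr_ge0// exprn_ge0//=; lra.
Qed.

Let measurable_wA i : measurable_fun [set: R] (fun x => (1 - x) ^+ i * wA x).
Proof.
have m2 : measurable_fun [set: R] (fun x => 1 - x) by exact: measurable_funB.
apply: measurable_funM; first exact: measurable_funX.
apply: measurable_funM.
  by apply: measurable_funM; [exact: measurable_funX|exact: measurable_fun_powR].
apply: measurable_funM; last exact: measurable_fun_powR.
by apply: measurable_funM; [exact: measurable_funX|exact: measurable_fun_powR].
Qed.

Let measurable_wM j : measurable_fun [set: R] (fun t => t ^+ j * wM t).
Proof.
have m2 : measurable_fun [set: R] (fun x => 1 - x) by exact: measurable_funB.
apply: measurable_funM; first exact: measurable_funX.
apply: measurable_funM.
  by apply: measurable_funM; [exact: measurable_funX|exact: measurable_fun_powR].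
by apply: measurable_funM; [exact: measurable_funX|exact: measurable_fun_powR].
Qed.

Let wA_ge0 x : 0 <= x <= 1 -> 0 <= wA x.
Proof.
move=> /andP[x0 x1]; rewrite /wA !mulr_ge0// ?powR_ge0// exprn_ge0//.
by rewrite subr_ge0.
Qed.

Let wM_ge0 x : 0 <= x <= 1 -> 0 <= wM x.
Proof.
move=> /andP[x0 x1]; rewrite /wM !mulr_ge0// ?powR_ge0// exprn_ge0//.
by rewrite subr_ge0.
Qed.

(** Tonelli, then y = (1 - x) t in the inner integral, where 1 - x - y = (1 - x)(1 - t). The point x
    = 1 is excluded because the substitution degenerates there. Integrals stay extended-valued, as
    finiteness comes later. *)
Lemma jacobi_moment i j :
  (\int[@lebesgue_measure R \x @lebesgue_measure R]_(z in triangle R)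
      (moment_integrand i j z)%:E =
   (\int[mu]_(x in `[0%R, 1%R[) ((1 - x) ^+ (i + j) * wA x)%:E) *
   (\int[mu]_(t in `[0%R, 1%R]) (t ^+ j * wM t)%:E))%E.
Proof.
rewrite integral_mkcond.
set F := (_ \_ (triangle R)).
have mF : measurable_fun [set: R * R] F.
  apply/(measurable_restrictT _ measurable_triangle)/measurable_EFinP.
  by apply: measurable_funTS; exact: measurable_moment_integrand.
have F0 z : (0 <= F z)%E.
  by apply: erestrict_ge0 => {}z zT; rewrite lee_fin moment_integrand_ge0.
rewrite fubini_tonelli1//.
set Mj := (X in (_ * X)%E).
have Mj0 : (0 <= Mj)%E.
  apply: integral_ge0 => t /=; rewrite in_itv/= lee_fin => t01.
  by rewrite mulr_ge0 ?wM_ge0// exprn_ge0//; case/andP: t01.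
rewrite [X in (X * _)%E]integral_mkcond.
set G := (_ \_ `[0, 1[%classic).
have mG : measurable_fun [set: R] G.
  apply/(measurable_restrictT _ (measurable_itv _))/measurable_EFinP.
  by apply: measurable_funTS; exact: measurable_wA.
have G0 x : (0 <= G x)%E.
  apply: erestrict_ge0 => {}x /=; rewrite in_itv/= lee_fin => /andP[x0 x1].
  by rewrite mulr_ge0 ?wA_ge0 ?x0 ?(ltW x1)// exprn_ge0// subr_ge0 ltW.
rewrite -ge0_integralZr//.
apply: eq_integral => x _; rewrite /fubini_F.
have mFx : measurable_fun [set: R] (fun y => F (x, y)).
  exact: measurableT_comp.
have [/= x01|x01] := boolP (x \in `[0%R, 1%R[%R); last first.
  (* Outside [0, 1[ the section of the triangle is empty or a single point. *)
  have -> : G x = 0%E by rewrite /G patchE ifN// notin_setE/=; apply/negP.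
  rewrite mul0e.
  transitivity (\int[mu]_(y in [set 0%R]) F (x, y))%E; last exact: integral_set1.
  rewrite [RHS]integral_mkcond; apply: eq_integral => y _.
  rewrite [RHS]patchE; case: ifPn => //; rewrite notin_setE/= => y0.
  rewrite /F patchE ifN// notin_setE/= => -[/= h1 h2 h3]; apply: y0.
  move: x01; rewrite in_itv/= h1/= -leNgt => ?.
  by apply/eqP; rewrite eq_le h2 andbT; lra.
have := x01; rewrite in_itv/= => /andP[x0 x1].
have z0 : 0 < 1 - x by rewrite subr_gt0.
rewrite (ge0_integral_dilation z0)//.
(* The part of the integrand depending on x alone; the Jacobian supplies the one power of 1 - x by
   which it differs from [wA]. *)
pose K := (1 - x) ^+ (i + j) * (x ^+ a * x `^ alpha *
  ((1 - x) ^+ (b + c) * (1 - x) `^ beta * (1 - x) `^ gamma)).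
have K0 : 0 <= K.
  by rewrite /K !mulr_ge0// ?powR_ge0// exprn_ge0// ltW.
pose H := (fun t => (t ^+ j * wM t)%:E) \_ `[0, 1]%classic.
have mH : measurable_fun [set: R] H.
  apply/(measurable_restrictT _ (measurable_itv _))/measurable_EFinP.
  by apply: measurable_funTS; exact: measurable_wM.
have FE t : F (x, (1 - x) * t) = (K%:E * H t)%E.
  rewrite /F /H !patchE.
  have -> : ((x, (1 - x) * t) \in triangle R) = (t \in `[0, 1]%classic).
    rewrite mem_setE in_itv/=; apply/idP/idP => [/set_mem[/= _]|].
      by rewrite pmulr_rge0// => -> ?; rewrite -(ler_pM2l z0); lra.
    move=> /andP[t0 t1]; apply: mem_set; split => //=.
      by rewrite pmulr_rge0.
    by move: t1; rewrite -(ler_pM2l z0); lra.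
  case: ifPn => [|_]; last by rewrite mule0.
  rewrite mem_setE in_itv/= => /andP[t0 t1].
  rewrite -EFinM; congr EFin.
  rewrite /moment_integrand /side_factor /jacobi_weight /K /wM/=.
  have -> : 1 - x - (1 - x) * t = (1 - x) * (1 - t) by ring.
  rewrite !powRM ?subr_ge0// ?ltW// !exprMn !exprD; ring.
under eq_integral do rewrite FE.
rewrite ge0_integralZl//; last first.
  move=> t _; apply: erestrict_ge0 => {}t /=; rewrite in_itv/= lee_fin => t01.
  by rewrite mulr_ge0 ?wM_ge0// exprn_ge0//; case/andP: t01.
rewrite muleA -EFinM /Mj [in RHS]integral_mkcond; congr (_ * _)%E.
rewrite /G patchE ifT ?inE//; congr EFin.
by rewrite /K /wA exprS; ring.
Qed.

Lemma jacobi_node_bound (N s m : nat) (w x y : 'I_N -> R) :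
  (forall k, x k != 1) ->
  (forall i j, (i + j <= s)%N ->
    (\int[@lebesgue_measure R \x @lebesgue_measure R]_(z in triangle R)
      (side_factor a b c z.1 z.2 * ((1 - z.1) ^+ i * z.2 ^+ j) *
        jacobi_weight alpha beta gamma z)%:E)%E =
    (\sum_k w k * ((1 - x k) ^+ i * y k ^+ j))%:E) ->
  ((2 * m <= s.+2)%N -> ((m * m.+1)./2 <= N)%N) /\
  ((2 * m <= s.+1)%N -> ((m * m.+1)./2 + m./2 <= N)%N).
Proof.
move=> x1 moments.
have mwA : measurable_fun [set: R] wA.
  have -> : wA = fun u => (1 - u) ^+ 0 * wA u.
    by apply/funext => u; rewrite mul1r.
  exact: measurable_wA.
have mwM : measurable_fun [set: R] wM.
  have -> : wM = fun u => u ^+ 0 * wM u.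
    by apply/funext => u; rewrite mul1r.
  exact: measurable_wM.
have wA_gt0 u : 0 < u < 1 -> 0 < wA u.
  move=> /andP[u0 u1]; rewrite /wA !mulr_gt0 ?powR_gt0 ?exprn_gt0 ?subr_gt0//.
have wM_gt0 u : 0 < u < 1 -> 0 < wM u.
  move=> /andP[u0 u1]; rewrite /wM !mulr_gt0 ?powR_gt0 ?exprn_gt0 ?subr_gt0//.
have co01 : `]0, 1[%classic `<=` (`[0, 1[%classic : set R).
  by apply: subset_itvr; rewrite bnd_simp.
have cc01 : `]0, 1[%classic `<=` (`[0, 1]%classic : set R).
  by apply: subset_itv; rewrite bnd_simp.
have co_le u : (`[0, 1[%classic : set R) u -> 0 <= u <= 1.
  by rewrite /= in_itv/= => /andP[-> /ltW ->].
have cc_le u : (`[0, 1]%classic : set R) u -> 0 <= u <= 1 by rewrite /= in_itv.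
have IA_gt0 : (0 < \int[mu]_(u in `[0%R, 1%R[) (wA u)%:E)%E.
  apply: (integral_gt0_cofinite (C := set0)) => //.
  - exact: measurable_funTS.
  - by move=> u u01; apply: wA_ge0; exact: co_le.
  - by move=> u u01 _; exact: wA_gt0.
have IM_gt0 : (0 < \int[mu]_(u in `[0%R, 1%R]) (wM u)%:E)%E.
  apply: (integral_gt0_cofinite (C := set0)) => //.
  - exact: measurable_funTS.
  - by move=> u u01 _; exact: wM_gt0.
(* Both factors of the finite moment are positive, hence finite. *)
have I00 : ((\sum_k w k * ((1 - x k) ^+ 0 * y k ^+ 0))%:E =
    (\int[mu]_(u in `[0%R, 1%R[) (wA u)%:E) *
    (\int[mu]_(u in `[0%R, 1%R]) (wM u)%:E))%E.
  rewrite -moments// jacobi_moment; congr (_ * _)%E;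
  by apply: eq_integral => u _; rewrite mul1r.
have iwA : mu.-integrable (`[0, 1[%classic : set R) (EFin \o wA).
  apply/integrableP; split; first exact/measurable_EFinP/measurable_funTS.
  under eq_integral.
    move=> u /set_mem u01; rewrite gee0_abs/= ?lee_fin ?wA_ge0 ?(co_le _ u01)//.
    over.
  rewrite ltey; apply/eqP => IAy; move: I00; rewrite IAy gt0_mulye//.
have iwM : mu.-integrable (`[0, 1]%classic : set R) (EFin \o wM).
  apply/integrableP; split; first exact/measurable_EFinP/measurable_funTS.
  under eq_integral.
    move=> u /set_mem u01; rewrite gee0_abs/= ?lee_fin ?wM_ge0 ?(cc_le _ u01)//.
    over.
  rewrite ltey; apply/eqP => IMy; move: I00; rewrite IMy gt0_muley//.
have m1B : measurable_fun [set: R] (fun u : R => 1 - u).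
  exact: measurable_funB.
have A01 u : (`[0, 1[%classic : set R) u -> 0 <= 1 - u <= 1.
  by move=> /co_le; lra.
have mid : measurable_fun [set: R] (idfun : R -> R) by exact: measurable_id.
have mco : measurable (`[0, 1[%classic : set R) by exact: measurable_itv.
have mcc : measurable (`[0, 1]%classic : set R) by exact: measurable_itv.
have [A AE] := exists_weighted_functional mco m1B A01 iwA.
have [M ME] := exists_weighted_functional mcc mid cc_le iwM.
apply: (@collapsed_cubature_bound _ A M N s m w
  (fun k => 1 - x k) (fun k => y k / (1 - x k))).
- move=> k p.
  apply: (weighted_functional_gt0 k mco co01 _ m1B _ _ _ _ _ AE).
  + by move=> u v /= /(congr1 (fun t => 1 - t)); rewrite !subKr.
  + exact: measurable_funTS.
  + by move=> u /A01/andP[].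
  + by move=> u u01; exact/wA_ge0/co_le.
  + by move=> u; lra.
  + exact: wA_gt0.
- move=> p p0; rewrite -[p ^+ 2]mul1r -(expr0 'X).
  apply: (weighted_functional_gt0 0 mcc cc01 _ _ _ _ _ _ _ ME) => //.
  + exact: measurable_funTS.
  + by move=> u u01; have /andP[] := cc_le u u01.
  + by move=> u /andP[].
(* At t = y / (1 - x), z^d t^j is (1 - x)^(d-j) y^j, so the moment with i = d - j applies. *)
- move=> d j /andP[jd ds].
  have := jacobi_moment (d - j) j; rewrite [LHS]moments ?subnK// => E.
  apply: EFin_inj; rewrite EFinM -AE -ME.
  under [X in _ = (X * _)%E]eq_integral do rewrite hornerXn.
  under [X in _ = (_ * X)%E]eq_integral do rewrite hornerXn.
  rewrite -[RHS]E; congr EFin; apply: eq_bigr => k _.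
  have xk : 1 - x k != 0 by rewrite subr_eq0 eq_sym.
  rewrite expr_div_n -[in LHS](subnK jd) exprD -(mulrA _ _ (_ / _)).
  by rewrite (mulrC (_ ^+ j)) divfK// expf_neq0.
Qed.
End Analysis.

(** * Lobatto rules *)

Section LobattoRule.
Local Open Scope classical_set_scope.
Context {R : realType}.

Definition test_poly (a b c i j : nat) : mpoly 2 R :=
  side_factor a b c (mpolyX R (mnm1 ord0)) (mpolyX R (mnm1 ord_max)) *
  ((1 - mpolyX R (mnm1 ord0)) ^+ i * mpolyX R (mnm1 ord_max) ^+ j).

Lemma peval_test_poly a b c i j (x y : R) :
  peval (test_poly a b c i j) x y =
  side_factor a b c x y * ((1 - x) ^+ i * y ^+ j).
Proof.
by rewrite /peval /test_poly /side_factor !(rmorphM, rmorphXn, rmorphB, rmorph1)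
  /= !mevalXU.
Qed.

Let msize_mulW (p q : mpoly 2 R) d e : (mmeasure mdeg p <= d.+1)%N ->
  (mmeasure mdeg q <= e.+1)%N -> (mmeasure mdeg (p * q)%R <= (d + e).+1)%N.
Proof.
have [->|p0] := eqVneq p 0; first by rewrite mul0r mmeasure0.
have [->|q0] := eqVneq q 0; first by rewrite mulr0 mmeasure0.
move=> pd qe; have := leq_add pd qe; rewrite msizeM// addSn addnS.
by case: (mmeasure mdeg p + mmeasure mdeg q)%N.
Qed.

Let msize_expW (p : mpoly 2 R) k : (mmeasure mdeg p <= 2)%N ->
  (mmeasure mdeg (p ^+ k)%R <= k.+1)%N.
Proof.
move=> p1; elim: k => [|k IHk]; first by rewrite expr0 msize1.
by rewrite exprS; exact: (msize_mulW p1 IHk).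
Qed.

Lemma msize_test_poly a b c i j :
  (mmeasure mdeg (test_poly a b c i j) <= (a + b + c + i + j).+1)%N.
Proof.
have mX k : (mmeasure mdeg (mpolyX R (mnm1 k) : mpoly 2 R) <= 2)%N.
  by rewrite msizeX mdeg1.
have mB (p q : mpoly 2 R) : (mmeasure mdeg p <= 2)%N ->
    (mmeasure mdeg q <= 2)%N -> (mmeasure mdeg (p - q)%R <= 2)%N.
  move=> p2 q2; rewrite (leq_trans (msizeD_le _ _))// geq_max p2/=.
  by rewrite msizeN.
have m1 : (mmeasure mdeg (1 : mpoly 2 R) <= 2)%N by rewrite msize1.
rewrite -(addnA _ i j); apply: msize_mulW; apply: msize_mulW.
- by apply: msize_mulW; exact: msize_expW.
- exact/msize_expW/mB/mX/mB.
- exact/msize_expW/mB.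
- exact: msize_expW.
Qed.

(** A small shift to the right from abscissa 1 leaves the triangle. *)
Lemma interior_triangle_neq1 (z : R * R) : interior (triangle R) z -> z.1 != 1.
Proof.
move=> /nbhs_ballP[e /= e0 eT]; apply/eqP => z1.
have e2 : 0 < e / 2 by rewrite divr_gt0.
have /eT[/= _ y0] : ball z e (z.1 + e / 2, z.2).
  split => /=; last exact: ballxx.
  rewrite /ball/= opprD addrA subrr sub0r normrN gtr0_norm//.
  by rewrite ltr_pdivrMr// ltr_pMr// ltr1n.
by rewrite z1; lra.
Qed.

(** * Elimination of boundary nodes by side factors *)

Variables (alpha beta gamma : R) (S N0 N1 N2 N3 : nat).
Variable rule : lobatto_rule alpha beta gamma S N0 N1 N2 N3.

Lemma lobatto_moments a b c s : (a + b + c + s <= S)%N -> forall i j,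
  (i + j <= s)%N ->
  let g x y := side_factor a b c x y * ((1 - x) ^+ i * y ^+ j) in
  (\int[@lebesgue_measure R \x @lebesgue_measure R]_(z in triangle R)
    (g z.1 z.2 * jacobi_weight alpha beta gamma z)%:E)%E =
  (\sum_(k < N0) weight0 rule k * g (node0 rule k).1 (node0 rule k).2 +
   \sum_(k < N1) weight1 rule k * g (node1 rule k) 0 +
   \sum_(k < N2) weight2 rule k * g 0 (node2 rule k) +
   \sum_(k < N3) weight3 rule k * g (node3 rule k) (1 - node3 rule k) +
   mu0 rule * g 0 0 + mu1 rule * g 1 0 + mu2 rule * g 0 1)%:E.
Proof.
move=> abcS i j ijs g.
have fS : (mmeasure mdeg (test_poly a b c i j) <= S.+1)%N.
  by rewrite (leq_trans (msize_test_poly _ _ _ _ _))//; lia.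
have gE x y : g x y = peval (test_poly a b c i j) x y by rewrite peval_test_poly.
have := lobatto_exact rule fS; rewrite /jacobi_integral => E.
under eq_integral do rewrite gE.
rewrite E; congr EFin.
rewrite !gE; congr (_ + _ + _ + _ + _ + _ + _);
by apply: eq_bigr => k _; rewrite gE.
Qed.

Let node0_neq1 k : (node0 rule k).1 != 1.
Proof. exact/interior_triangle_neq1/node0_interior. Qed.

Let side_factor0y a' b c (y : R) : side_factor a'.+1 b c 0 y = 0.
Proof. by rewrite /side_factor exprS !mul0r. Qed.

Let side_factorx0 a b' c (x : R) : side_factor a b'.+1 c x 0 = 0.
Proof. by rewrite /side_factor exprS mul0r mulr0 mul0r. Qed.

Let side_factorx1 a b c' (x : R) : side_factor a b c'.+1 x (1 - x) = 0.
Proof. by rewrite /side_factor subrr exprS mul0r mulr0. Qed.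

Let side_factor10 a b c' : side_factor a b c'.+1 1 0 = 0 :> R.
Proof. by have := side_factorx1 a b c' 1; rewrite subrr. Qed.

Let side_factor01 a b c' : side_factor a b c'.+1 0 1 = 0 :> R.
Proof. by have := side_factorx1 a b c' 0; rewrite subr0. Qed.

Let sum_mul0 n (v h : 'I_n -> R) : (forall k, h k = 0) -> \sum_k v k * h k = 0.
Proof. by move=> h0; rewrite big1// => k _; rewrite h0 mulr0. Qed.

(** The factor xy(1-x-y) kills all boundary nodes, costs three degrees of precision and is absorbed
    into the weights at the interior nodes. *)
Lemma interior_node_bound m s : (3 + s <= S)%N ->
  ((2 * m <= s.+2)%N -> ((m * m.+1)./2 <= N0)%N) /\
  ((2 * m <= s.+1)%N -> ((m * m.+1)./2 + m./2 <= N0)%N).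
Proof.
move=> sS; apply: (@jacobi_node_bound R alpha beta gamma 1 1 1 N0 s m
  (fun k => weight0 rule k *
     side_factor 1 1 1 (node0 rule k).1 (node0 rule k).2)
  (fun k => (node0 rule k).1) (fun k => (node0 rule k).2)) => // i j ijs.
rewrite (lobatto_moments _ ijs)//; congr EFin.
rewrite side_factor0y side_factor10 side_factor01 !(mul0r, mulr0) !addr0.
rewrite [X in _ + X + _ + _]sum_mul0 => [|k]; last first.
  by rewrite side_factorx0 mul0r.
rewrite [X in _ + X + _]sum_mul0 => [|k]; last by rewrite side_factor0y mul0r.
rewrite [X in _ + X]sum_mul0 => [|k]; last by rewrite side_factorx1 mul0r.
by rewrite !addr0; apply: eq_bigr => k _; rewrite mulrA.
Qed.

(* [Ni] boundary nodes are added to the interior ones; [a], [b], [c] are chosen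
   so that [side_factor a b c] vanishes at all the other nodes of the rule. *)
Let side_node_bound a b c (Ni : nat) (wi xi yi : 'I_Ni -> R) m s :
  (a + b + c + s <= S)%N -> (forall k, xi k != 1) ->
  (forall i j, (i + j <= s)%N ->
    let g x y := side_factor a b c x y * ((1 - x) ^+ i * y ^+ j) in
    \sum_(k < N1) weight1 rule k * g (node1 rule k) 0 +
    \sum_(k < N2) weight2 rule k * g 0 (node2 rule k) +
    \sum_(k < N3) weight3 rule k * g (node3 rule k) (1 - node3 rule k) +
    mu0 rule * g 0 0 + mu1 rule * g 1 0 + mu2 rule * g 0 1 =
    \sum_(k < Ni) wi k * g (xi k) (yi k)) ->
  ((2 * m <= s.+2)%N -> ((m * m.+1)./2 <= N0 + Ni)%N) /\
  ((2 * m <= s.+1)%N -> ((m * m.+1)./2 + m./2 <= N0 + Ni)%N).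
Proof.
move=> sS xi1 side.
pose glue (u0 : 'I_N0 -> R) (ui : 'I_Ni -> R) (k : 'I_(N0 + Ni)) :=
  match fintype.split k with inl k0 => u0 k0 | inr ki => ui ki end.
have glue0 u0 ui k : glue u0 ui (lshift Ni k) = u0 k.
  by rewrite /glue (unsplitK (inl k)).
have gluei u0 ui k : glue u0 ui (rshift N0 k) = ui k.
  by rewrite /glue (unsplitK (inr k)).
pose x := glue (fun k => (node0 rule k).1) xi.
pose y := glue (fun k => (node0 rule k).2) yi.
apply: (@jacobi_node_bound R alpha beta gamma a b c _ s m
  (fun k => glue (weight0 rule) wi k * side_factor a b c (x k) (y k)) x y).
  by move=> k; rewrite /x /glue; case: (fintype.split k).
move=> i j ijs; rewrite (lobatto_moments sS ijs); congr EFin.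
rewrite big_split_ord/= -!(addrA (\sum_(k < N0) _)); congr (_ + _).
  by apply: eq_bigr => k _; rewrite /x /y !glue0 mulrA.
rewrite (side i j ijs); apply: eq_bigr => k _.
by rewrite /x /y !gluei mulrA.
Qed.

(** The factor x(1-x-y) vanishes on the two other sides, hence at every vertex, and costs only two
    degrees. The other sides use y(1-x-y) and xy in the same way. *)
Lemma side1_node_bound m s : (2 + s <= S)%N ->
  ((2 * m <= s.+2)%N -> ((m * m.+1)./2 <= N0 + N1)%N) /\
  ((2 * m <= s.+1)%N -> ((m * m.+1)./2 + m./2 <= N0 + N1)%N).
Proof.
move=> sS; apply: (@side_node_bound 1 0 1 N1 (weight1 rule) (node1 rule)
  (fun=> 0)) => // [k|i j ijs g].
  by rewrite lt_eqF//; case/andP: (node1_open rule k).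
have g0y y : g 0 y = 0 by rewrite /g side_factor0y mul0r.
have gx1 x : g x (1 - x) = 0 by rewrite /g side_factorx1 mul0r.
have g10 : g 1 0 = 0 by rewrite /g side_factor10 mul0r.
rewrite !g0y g10 !mulr0 !addr0.
by rewrite [X in _ + X + _]sum_mul0// [X in _ + X]sum_mul0// !addr0.
Qed.

Lemma side2_node_bound m s : (2 + s <= S)%N ->
  ((2 * m <= s.+2)%N -> ((m * m.+1)./2 <= N0 + N2)%N) /\
  ((2 * m <= s.+1)%N -> ((m * m.+1)./2 + m./2 <= N0 + N2)%N).
Proof.
move=> sS; apply: (@side_node_bound 0 1 1 N2 (weight2 rule) (fun=> 0)
  (node2 rule)) => // [k|i j ijs g]; first by rewrite eq_sym oner_eq0.
have gx0 x : g x 0 = 0 by rewrite /g side_factorx0 mul0r.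
have gx1 x : g x (1 - x) = 0 by rewrite /g side_factorx1 mul0r.
have g01 : g 0 1 = 0 by rewrite /g side_factor01 mul0r.
rewrite !gx0 g01 !mulr0 !addr0.
by rewrite [X in X + _ + _]sum_mul0// [X in _ + X]sum_mul0// add0r addr0.
Qed.

Lemma side3_node_bound m s : (2 + s <= S)%N ->
  ((2 * m <= s.+2)%N -> ((m * m.+1)./2 <= N0 + N3)%N) /\
  ((2 * m <= s.+1)%N -> ((m * m.+1)./2 + m./2 <= N0 + N3)%N).
Proof.
move=> sS; apply: (@side_node_bound 1 1 0 N3 (weight3 rule) (node3 rule)
  (fun k => 1 - node3 rule k)) => // [k|i j ijs g].
  by rewrite lt_eqF//; case/andP: (node3_open rule k).
have gx0 x : g x 0 = 0 by rewrite /g side_factorx0 mul0r.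
have g0y y : g 0 y = 0 by rewrite /g side_factor0y mul0r.
rewrite !gx0 !g0y !mulr0 !addr0.
by rewrite [X in X + _ + _]sum_mul0// [X in _ + X + _]sum_mul0// !add0r.
Qed.

End LobattoRule.

Theorem theorem2p1 (R : realType) (alpha beta gamma : R)
    (n s N0 N1 N2 N3 : nat)
    (halpha : -1 < alpha) (hbeta : -1 < beta) (hgamma : -1 < gamma)
    (hn : (1 <= n)%N) (hs : s = (2 * n - 1)%N \/ s = (2 * n)%N)
    (hrule : inhabited (lobatto_rule alpha beta gamma s N0 N1 N2 N3)) :
  [/\ s = (2 * n - 1)%N -> (n * (n - 1) %/ 2 <= N0)%N,
      s = (2 * n)%N -> (n * (n - 1) %/ 2 + (n - 1) %/ 2 <= N0)%N
    & forall i : 'I_3, let Ni := tnth [tuple N1; N2; N3] i in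
      (s = (2 * n - 1)%N -> (n * (n - 1) %/ 2 + (n - 1) %/ 2 <= N0 + Ni)%N) /\
      (s = (2 * n)%N -> (n * (n + 1) %/ 2 <= N0 + Ni)%N)].
Proof.
case: hrule => rule; clear hs; case: n hn => // n _.
rewrite subSS subn0 !divn2 (mulnC n.+1 n) addn1.
have side_bound (i : 'I_3) m s' : (2 + s' <= s)%N ->
    ((2 * m <= s'.+2)%N ->
      ((m * m.+1)./2 <= N0 + tnth [tuple N1; N2; N3] i)%N) /\
    ((2 * m <= s'.+1)%N ->
      ((m * m.+1)./2 + m./2 <= N0 + tnth [tuple N1; N2; N3] i)%N).
  case: i => [[|[|[|//]]] i3]; rewrite (tnth_nth 0%N)/= => s2.
  - exact: (side1_node_bound rule m s2).
  - exact: (side2_node_bound rule m s2).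
  - exact: (side3_node_bound rule m s2).
split.
(* The original parameter is now n + 2, its value 1 giving a zero bound. With m = n + 1, three
   degrees less than s leave precision 2m - 2 here and 2m - 1 in the next case. *)
- case: n => [//|n] sE.
  have sS : (3 + 2 * n <= s)%N by lia.
  have [+ _] := interior_node_bound rule n.+1 sS.
  by apply; lia.
- case: n => [//|n] sE.
  have sS : (3 + (2 * n).+1 <= s)%N by lia.
  have [_] := interior_node_bound rule n.+1 sS.
  by apply; lia.
- move=> i Ni; split.
    case: n => [//|n] sE.
    have sS : (2 + (2 * n).+1 <= s)%N by lia.
    have [_] := side_bound i n.+1 _ sS.
    by apply; lia.
  (* Here m is the original parameter n + 1 itself: two degrees less than 2m leave precision 2m -
     2. *)
  move=> sE; have sS : (2 + 2 * n <= s)%N by lia.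
  have [+ _] := side_bound i n.+1 _ sS.
  by apply; lia.
Qed.
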